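(* Let $f\in\mathrm{Homeo}_0(\mathbb{T}^d)$ with lift $F$, and let $K\subseteq\mathbb{T}^d$ be a compact $f$-invariant set. Suppose that $f_{|K}$ is minimal and that there exists a linear subspace $V\subseteq\mathbb{R}^d$ such that $\rho_K(F)\subseteq v_0+V^\perp$ for some vector $v_0\in V$. Further, assume that for every $v\in V\setminus\{0\}$ the deviations parallel to $v$ are unbounded on $K$, i.e. $\sup_{n\in\mathbb{N},\,z\in K}|D_v(n,z)|=\infty$. Then there exists a residual set $\mathcal{R}\subseteq K$ such that for all $z\in\mathcal{R}$ $$\sup_{n\in\mathbb{N}}D_v(n,z)\;=\;-\inf_{n\in\mathbb{N}}D_v(n,z)\;=\;\infty\qquad\text{for all } v\in V\setminus\{0\}.$$
   Context: $\mathbb{T}^d=\mathbb{R}^d/\mathbb{Z}^d$ with quotient map $\pi$. $\mathrm{Homeo}_0(\mathbb{T}^d)$ is the set of homeomorphisms of $\mathbb{T}^d$ homotopic to the identity; a lift of $f$ is a continuous $F:\mathbb{R}^d\to\mathbb{R}^d$ with $\pi\circ F=f\circ\pi$. Points of $\mathbb{T}^d$ are identified with their lifts when the choice of lift does not matter; in particular $F^n(z)-z$ is well defined for $z\in\mathbb{T}^d$. $f$-invariant means $f(K)=K$. For $A\subseteq\mathbb{T}^d$, the rotation set of $F$ on $A$ is $\rho_A(F)=\{\rho\in\mathbb{R}^d\mid\exists\, n_i\nearrow\infty,\ x_i\in A:\ \lim_{i\to\infty}(F^{n_i}(x_i)-x_i)/n_i=\rho\}$. For $v\in V\setminus\{0\}$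 and $z\in K$ the deviations from the constant rotation parallel to $v$ are $D_v(n,z)=\langle F^n(z)-z-n\rho,v\rangle$, where $\rho$ is any vector in $v_0+V^\perp$ (the value does not depend on the choice). $f_{|K}$ is minimal if every orbit in $K$ is dense in $K$. A residual subset of $K$ is a dense $G_\delta$ subset of $K$. *)

(* Defs.v *)
From HB Require Import structures.
From mathcomp Require Import all_boot all_order all_algebra.
From mathcomp Require Import all_classical all_reals all_analysis.
From mathcomp Require Import generic_quotient borel_hierarchy ring.

Set Implicit Arguments.
Unset Strict Implicit.
Unset Printing Implicit Defensive.

Import Order.TTheory GRing.Theory Num.Theory.
Import numFieldNormedType.Exports.

Local Open Scope classical_set_scope.
Local Open Scope ring_scope.
Local Open Scope quotient_scope.

Section torus.
Variables (R : realType) (d : nat).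

Definition torus_rel : rel 'rV[R]_d :=
  fun x y => [forall i, (x 0 i - y 0 i) \is a Num.int].

Lemma torus_rel_refl : reflexive torus_rel.
Proof. by move=> x; apply/forallP => i; rewrite subrr rpred0. Qed.

Lemma torus_rel_sym : symmetric torus_rel.
Proof.
by move=> x y; apply/forallP/forallP => h i; rewrite -opprB rpredN.
Qed.

Lemma torus_rel_trans : transitive torus_rel.
Proof.
move=> y x z /forallP xy /forallP yz; apply/forallP => i.
by rewrite -(subrKA (y 0 i)) rpredD.
Qed.

Canonical torus_equiv :=
  EquivRel torus_rel torus_rel_refl torus_rel_sym torus_rel_trans.

Definition torus : topologicalType := quotient_topology {eq_quot torus_rel}.

Definition torus_pi (x : 'rV[R]_d) : torus :=
  \pi_(quotient_topology {eq_quot torus_rel}) x.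

Definition torus_repr (z : torus) : 'rV[R]_d :=
  repr (z : quotient_topology {eq_quot torus_rel}).

Lemma torus_piP x y :
  torus_pi x = torus_pi y <-> forall i, (x 0 i - y 0 i) \is a Num.int.
Proof.
rewrite /torus_pi; split=> [/(@eqquotP _ torus_equiv)/forallP//|h].
by apply/(@eqquotP _ torus_equiv)/forallP.
Qed.

Lemma torus_reprK z : torus_pi (torus_repr z) = z.
Proof. exact: reprK. Qed.

Lemma torus_pi_continuous : continuous torus_pi.
Proof. exact: pi_continuous. Qed.

End torus.

Definition homeomorphism (X Y : topologicalType) (f : X -> Y) : Prop :=
  continuous f /\ exists g : Y -> X, [/\ continuous g, cancel f g & cancel g f].

Definition homotopic (R : realType) (X Y : topologicalType) (f g : X -> Y) :
    Prop :=
  exists H : R * X -> Y,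
    [/\ {within `[0, 1] `*` [set: X], continuous H},
        forall x, H (0, x) = f x & forall x, H (1, x) = g x].

Definition Homeo0 (R : realType) (d : nat) : set (torus R d -> torus R d) :=
  [set f | homeomorphism f /\ homotopic R f id].

Definition is_lift (R : realType) (d : nat) (f : torus R d -> torus R d)
    (F : 'rV[R]_d -> 'rV[R]_d) : Prop :=
  continuous F /\ forall x, torus_pi (F x) = f (torus_pi x).

(* The two-sided orbit of x under an invertible map f. *)
Definition full_orbit (X : Type) (f : X -> X) (x : X) : set X :=
  [set y | exists n, y = iter n f x \/ x = iter n f y].

Definition minimal_on (X : topologicalType) (f : X -> X) (K : set X) : Prop :=
  forall z, K z -> K `<=` closure (full_orbit f z).

(* G_delta subsets of the subspace K are the traces on K of G_delta sets. *)
Definition residual_in (X : topologicalType) (K A : set X) : Prop :=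
  (exists2 G, Gdelta G & A = K `&` G) /\ K `<=` closure A.

Section rotation.
Variables (R : realType) (d : nat).
Implicit Types (F : 'rV[R]_d -> 'rV[R]_d) (v rho : 'rV[R]_d).

(* F^n(z) - z for z in the torus. If F lifts a map homotopic to the identity,
   then F (x + k) = F x + k for every integer vector k, so that the choice of
   the representative of z is irrelevant. *)
Definition displacement F (n : nat) (z : torus R d) : 'rV[R]_d :=
  iter n F (torus_repr z) - torus_repr z.

Definition rotation_set F (A : set (torus R d)) : set 'rV[R]_d :=
  [set rho | exists (n : nat -> nat) (x : nat -> torus R d),
    [/\ increasing_seq n, forall i, A (x i) &
        (n i)%:R^-1 *: displacement F (n i) (x i) @[i --> \oo] --> rho]].

Definition dotv (u v : 'rV[R]_d) : R := \sum_(i < d) u 0 i * v 0 i.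

Definition orthocompl (V : {vspace 'rV[R]_d}) : set 'rV[R]_d :=
  [set w | forall u, u \in V -> dotv w u = 0].

Definition deviation F rho v (n : nat) (z : torus R d) : R :=
  dotv (displacement F n z - n%:R *: rho) v.

Lemma deviation_indep F (V : {vspace 'rV[R]_d}) (v0 rho v : 'rV[R]_d) n z :
  [set v0 + w | w in orthocompl V] rho -> v \in V ->
  deviation F rho v n z = deviation F v0 v n z.
Proof.
move=> [w ow <-] vV; apply/eqP; rewrite -subr_eq0; apply/eqP.
have -> : deviation F (v0 + w) v n z - deviation F v0 v n z =
          - n%:R * dotv w v.
  rewrite /deviation /dotv -sumrB mulr_sumr; apply: eq_bigr => i _.
  by rewrite !mxE; ring.
by rewrite ow// mulr0.
Qed.

End rotation.

(* Main.v *)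
(* A homotopy from f to the identity writes F x = x + phi (pi x) with phi
   continuous on the torus, so the deviations are the sums of a continuous
   cocycle S over f. Call v a bounded direction of z if <S_n z, v> is bounded
   above in n; these form a convex cone B(z), invariant along orbits.

   For a fixed v, if B(z) contains v on a non-meagre set of z, then minimality
   makes the upper bound uniform on K, and since the rotation set excludes a
   drift along v, a Gottschalk-Hedlund argument bounds the deviations along v
   on both sides, contrary to hypothesis. So v is generically not in B(z).

   To treat all v at once, a zero-one law shows that for a compact set O of
   directions either B(z) meets O for every z, or B(z) misses O generically.
   Hence the closure of B(z) is generically a fixed closed cone T. If T spans,
   a point in its interior lies in B(z) for every z, which contradicts the case
   of a fixed direction; otherwise one projects the cocycle to the span of T
   and argues by induction on the dimension. *)

Require Import Defs.
From HB Require Import structures.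
From mathcomp Require Import all_boot all_order all_algebra.
From mathcomp Require Import all_classical all_reals all_analysis.
From mathcomp Require Import lra ring.

Set Implicit Arguments.
Unset Strict Implicit.
Unset Printing Implicit Defensive.

Import Order.TTheory GRing.Theory Num.Theory.
Import numFieldNormedType.Exports.

Local Open Scope classical_set_scope.
Local Open Scope ring_scope.

(** * Generic properties and the Baire category theorem *)

Section generically.
Variables (X : topologicalType) (K : set X).

(** Comeagreness relative to [K], witnessed by a sequence of open sets, so that countable
    intersections need no Baire argument. *)
Definition generically (P : X -> Prop) : Prop :=
  exists U : nat -> set X,
    [/\ forall n, open (U n), forall n, K `<=` closure (K `&` U n) &
        forall z, K z -> (forall n, U n z) -> P z].

Lemma generically_sub (P Q : X -> Prop) :
  (forall z, K z -> P z -> Q z) -> generically P -> generically Q.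
Proof.
by move=> PQ [U [oU dU UP]]; exists U; split => // z Kz Uz; exact/PQ/UP.
Qed.

Lemma generically_all (P : X -> Prop) : (forall z, K z -> P z) -> generically P.
Proof.
move=> KP; exists (fun=> setT); split => [n|n|z Kz _]; last exact: KP.
  exact: openT.
by rewrite setIT; exact: subset_closure.
Qed.

Lemma generically_forall (I : countType) (P : I -> X -> Prop) :
  (forall i, generically (P i)) -> generically (fun z => forall i, P i z).
Proof.
move=> /choice[U UP].
(* All the sequences are merged into one, indexed by codes of pairs; numbers coding no pair get the
   whole space. *)
exists (fun m => if @unpickle (I * nat)%type m is Some p then U p.1 p.2
                 else setT); split.
- by move=> m; case: unpickle => [[i n]|]; [have [+ _ _] := UP i|exact: openT].
- move=> m; case: unpickle => [[i n]|]; first by have [_ + _] := UP i.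
  by rewrite setIT; exact: subset_closure.
- move=> z Kz Uz i; have [_ _ UPi] := UP i; apply: UPi => // n.
  by have := Uz (pickle (i, n)); rewrite pickleK.
Qed.

Lemma generically_and (P Q : X -> Prop) :
  generically P -> generically Q -> generically (fun z => P z /\ Q z).
Proof.
move=> gP gQ.
have /generically_forall : forall b : bool, generically (if b then P else Q).
  by case.
by apply: generically_sub => z _ PQ; split; [exact: (PQ true)|exact: (PQ false)].
Qed.

(** The Baire argument: nested open sets that meet [K], each with closure inside its predecessor and
    inside the next [U n], close in on a point of [K] near any given one. *)
Lemma generically_residual (P : X -> Prop) :
  hausdorff_space X -> compact [set: X] -> compact K -> generically P ->
  exists2 A, residual_in K A & forall z, A z -> P z.
Proof.
move=> hX cX cK [U [oU dU UP]].
exists (K `&` \bigcap_n U n); last by move=> z [Kz Uz]; apply: UP => // n; exact: Uz.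
split; first by exists (\bigcap_n U n) => //; exists U.
move=> x Kx B Bx.
have rX (y : X) (W : set X) : nbhs y W -> exists V, [/\ open V, V y & closure V `<=` W].
  move=> yW; have [V yV VW] := compact_regular hX cX (@filterT _ (nbhs y) _) yW.
  move: yV; rewrite nbhsE => -[V' [oV' V'y] V'V].
  by exists V'; split => //; apply: subset_trans VW; exact: closure_subset.
pose good (O : set X) := open O /\ (K `&` O) !=set0.
have step (p : nat * set X) : exists O', good p.2 ->
    good O' /\ closure O' `<=` p.2 `&` U p.1.
  case: p => n O /=; have [[oO [y [Ky Oy]]]|nO] := pselect (good O); last by exists set0.
  have [y' [[Ky' Uy'] Oy']] := dU n y Ky O (open_nbhs_nbhs (conj oO Oy)).
  have [|V [oV Vy' VOU]] := rX y' (O `&` U n).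
    by apply: open_nbhs_nbhs; split => //; exact: openI.
  by exists V => _; split => //; split => //; exists y'.
have [next nextP] := choice step.
have [V0 [oV0 V0x V0B]] := rX x B Bx.
pose O := fix O n := if n is m.+1 then next (m, O m) else V0.
have gO n : good (O n).
  elim: n => [|n IH]; first by split => //; exists x.
  by have [] := nextP (n, O n) IH.
have OS n : closure (O n.+1) `<=` O n `&` U n by have [] := nextP (n, O n) (gO n).
have Ole m n : (m <= n)%N -> O n `<=` O m.
  elim: n => [|n IH]; first by rewrite leqn0 => /eqP ->.
  rewrite leq_eqVlt => /predU1P[->//|/IH]; apply: subset_trans.
  by move=> y Oy; have [] := OS n y (subset_closure Oy).
have /choice[w wP] : forall n, exists w, (K `&` O n) w by move=> n; have [_] := gO n.
have [y [Ky cy]] : K `&` cluster (w @ \oo) !=set0.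
  by apply: cK; exists 0 => // n _; have [] := wP n.
have Oy n : closure (O n) y.
  move: cy; rewrite clusterE; apply; exists n => // m /= nm.
  by apply: (Ole _ _ nm); have [] := wP m.
exists y; split; last exact/V0B/(Oy 0).
by split => // n _; have [] := OS n y (Oy n.+1).
Qed.

End generically.

(** * Row vectors: pairing, continuity, positive cones, compact boxes *)

Section row_vectors.
Variable R : realType.

Lemma dotvE k (u v : 'rV[R]_k) : dotv u v = (u *m v^T) 0 0.
Proof. by rewrite mxE; apply: eq_bigr => i _; rewrite !mxE. Qed.

Lemma dotvDl k (u v w : 'rV[R]_k) : dotv (u + v) w = dotv u w + dotv v w.
Proof. by rewrite !dotvE mulmxDl mxE. Qed.

Lemma dotvBl k (u v w : 'rV[R]_k) : dotv (u - v) w = dotv u w - dotv v w.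
Proof. by rewrite !dotvE mulmxBl !mxE. Qed.

Lemma dotvZl k a (u w : 'rV[R]_k) : dotv (a *: u) w = a * dotv u w.
Proof. by rewrite !dotvE -scalemxAl mxE. Qed.

Lemma dotvZr k a (u w : 'rV[R]_k) : dotv u (a *: w) = a * dotv u w.
Proof. by rewrite !dotvE linearZ /= -scalemxAr mxE. Qed.

Lemma dotvNr k (u w : 'rV[R]_k) : dotv u (- w) = - dotv u w.
Proof. by rewrite -scaleN1r dotvZr mulN1r. Qed.

Lemma dotv_mulmx k m (u : 'rV[R]_k) (N : 'M[R]_(m, k)) (c : 'rV[R]_m) :
  dotv (u *m N^T) c = dotv u (c *m N).
Proof. by rewrite !dotvE trmx_mul mulmxA. Qed.

Lemma dotv_mulmxr k m (u : 'rV[R]_k) (N : 'M[R]_(m, k)) (c : 'rV[R]_m) :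
  dotv u (c *m N) = \sum_i c 0 i * dotv u (row i N).
Proof.
rewrite -dotv_mulmx /dotv; apply: eq_bigr => i _; rewrite mulrC; congr (_ * _).
by rewrite mxE; apply: eq_bigr => j _; rewrite !mxE.
Qed.

Lemma cvg_sumr (T : Type) (F : set_system T) {FF : Filter F} (I : Type)
    (r : seq I) (h : I -> T -> R) (a : I -> R) :
  (forall i, h i @ F --> a i) ->
  (fun x => \sum_(i <- r) h i x) @ F --> \sum_(i <- r) a i.
Proof.
move=> ha; apply: cvg_big => // ; exact: add_continuous.
Qed.

Lemma cvg_prodr (T : Type) (F : set_system T) {FF : Filter F} (I : Type)
    (r : seq I) (h : I -> T -> R) (a : I -> R) :
  (forall i, h i @ F --> a i) ->
  (fun x => \prod_(i <- r) h i x) @ F --> \prod_(i <- r) a i.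
Proof.
move=> ha; apply: cvg_big => //; exact: mul_continuous.
Qed.

Lemma cvg_coord (T : Type) (F : set_system T) {FF : Filter F} m n
    (h : T -> 'M[R]_(m, n)) (a : 'M[R]_(m, n)) :
  (forall i j, (h x i j) @[x --> F] --> a i j) <-> h @ F --> a.
Proof.
split=> [ha|ha i j]; last first.
  by apply: (@cvg_comp _ _ _ h (fun M : 'M[R]_(m, n) => M i j) F (nbhs a) _ ha);
    exact: coord_continuous.
move=> A [P aP PA]; rewrite nbhs_filterE /=.
apply: (filterS (P := [set x | forall ij : 'I_m * 'I_n, P ij.1 ij.2 (h x ij.1 ij.2)])).
  by move=> x Px; apply: PA => i j; exact: (Px (i, j)).
apply: filter_forall => -[i j] /=; exact: (ha i j _ (aP i j)).
Qed.

Lemma cvg_dotv (T : Type) (F : set_system T) {FF : Filter F} k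
    (h h' : T -> 'rV[R]_k) (a a' : 'rV[R]_k) :
  h @ F --> a -> h' @ F --> a' -> dotv (h x) (h' x) @[x --> F] --> dotv a a'.
Proof.
move=> /cvg_coord ha /cvg_coord ha'.
by apply: cvg_sumr => i; exact: cvgM.
Qed.

Lemma det_continuous k : continuous (fun A : 'M[R]_k => \det A).
Proof.
move=> A; apply: (@cvg_sumr _ (nbhs A) _) => s; apply: cvgM; first exact: cvg_cst.
by apply: (@cvg_prodr _ (nbhs A) _) => i; exact: coord_continuous.
Qed.

Lemma adjugate_continuous k i j : continuous (fun A : 'M[R]_k => (\adj A) i j).
Proof.
have -> : (fun A : 'M[R]_k => (\adj A) i j) =
    (fun A => (-1) ^+ (j + i) * \det (row' j (col' i A))).
  by apply/funext => A; rewrite mxE.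
move=> A; apply: (@cvgM _ _ (nbhs A) _); first exact: cvg_cst.
apply: (@cvg_comp _ _ _ (fun B : 'M[R]_k => row' j (col' i B))
  (fun B => \det B) (nbhs A) (nbhs (row' j (col' i A)))); last exact: det_continuous.
apply/cvg_coord => i' j'; rewrite !mxE; under eq_fun do rewrite !mxE.
exact: coord_continuous.
Qed.

(* By Cramer's rule the coordinates of the sum of the rows of N in the rows of
   a nearby A are close to 1, hence positive. *)
Lemma unitmx_row_cone k (N : 'M[R]_k) : N \in unitmx ->
  exists2 e : R, 0 < e & forall A : 'M[R]_k,
    (forall i j, `|A i j - N i j| < e) ->
    exists2 c : 'rV[R]_k, (forall i, 0 <= c 0 i) &
      exists2 s : R, 0 < s & c *m A = s *: (const_mx 1 *m N).
Proof.
rewrite unitmxE unitfE => N0.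
(* Up to the factor [\det A ^+ 2], these are the coordinates of the row sum of [N] in the rows of
   [A]; the adjugate makes them continuous everywhere. *)
pose h (A : 'M[R]_k) := \det A *: (const_mx 1 *m N *m \adj A) : 'rV[R]_k.
have hN i : 0 < h N 0 i.
  by rewrite /h -mulmxA mul_mx_adj mul_mx_scalar !mxE mulr1 -expr2 exprn_even_gt0.
have hc i : continuous (fun A => h A 0 i).
  have -> : (fun A => h A 0 i) =
      (fun A => \det A * \sum_j (const_mx 1 *m N : 'rV_k) 0 j * (\adj A) j i).
    by apply/funext => A; rewrite mxE; congr (_ * _); rewrite mxE.
  move=> A; apply: (@cvgM _ _ (nbhs A) _); first exact: det_continuous.
  by apply: (@cvg_sumr _ (nbhs A) _) => j; apply: cvgM; [exact: cvg_cst|exact: adjugate_continuous].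
have : \forall A \near N, \det A != 0 /\ forall i, 0 < h A 0 i.
  apply: filterI.
    have : \forall y \near \det N, y != 0 :> R.
      by apply: open_nbhs_nbhs; split => //; exact: open_neq.
    exact: det_continuous.
  apply: (@filter_forall _ _ (fun i A => 0 < h A 0 i) (nbhs N)) => i.
  exact: (hc i N _ (lt_nbhsr (hN i))).
case/nbhs_ballP => e /= e0 eN; exists e => // A AN.
have [|A0 hA] := eN A; first by split => // i j; rewrite -ball_normE /ball_ /= distrC AN.
exists (h A) => [i|]; first exact/ltW/hA.
exists (\det A ^+ 2); first by rewrite exprn_even_gt0.
by rewrite /h -scalemxAl -mulmxA mul_adj_mx mul_mx_scalar scalerA.
Qed.

Lemma box_compact k (v : 'rV[R]_k) (e : R) :
  compact [set w : 'rV[R]_k | forall i, `|w 0 i - v 0 i| <= e].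
Proof.
have -> : [set w : 'rV[R]_k | forall i, `|w 0 i - v 0 i| <= e] =
    [set w : 'rV[R]_k | forall i, `[v 0 i - e, v 0 i + e]%classic (w ord0 i)].
  by apply/seteqP; split=> w wv i; have := wv i; rewrite /= in_itv /= ler_distl.
apply: (@rV_compact R k (fun i => `[v 0 i - e, v 0 i + e]%classic)) => i.
exact: segment_compact.
Qed.

Lemma rat_approx k (v : 'rV[R]_k) (e : R) : 0 < e ->
  exists q : 'rV[rat]_k, forall i, `|ratr (q 0 i) - v 0 i| <= e.
Proof.
move=> e0.
have /choice[q qP] : forall i, exists q : rat, `|ratr q - v 0 i| <= e.
  move=> i; have [|q] := @rat_in_itvoo R (v 0 i - e) (v 0 i + e); first lra.
  by rewrite in_itv /= => qv; exists q; rewrite ler_distl; lra.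
by exists (\row_i q i) => i; rewrite mxE.
Qed.

End row_vectors.

Lemma iter_continuous (X : topologicalType) (h : X -> X) n :
  continuous h -> continuous (iter n h).
Proof.
move=> ch; elim: n => [|n IH] x; first exact: cvg_id.
by apply: (@cvg_comp _ _ _ (iter n h) h _ (nbhs (iter n h x))); [exact: IH|exact: ch].
Qed.

Lemma iter_cancel (X : Type) (h h' : X -> X) n :
  cancel h h' -> cancel (iter n h) (iter n h').
Proof. by move=> hK; elim: n => // n IH x; rewrite iterSr iterS hK IH. Qed.

Lemma ge_closure (R : realType) (X : topologicalType) (h : X -> R) (E : set X)
    (a : R) z :
  continuous h -> (forall y, E y -> a <= h y) -> closure E z -> a <= h z.
Proof.
move=> ch Eh Ez; rewrite leNgt; apply/negP => hza.
have [y [Ey /=]] := Ez _ (ch z _ (lt_nbhsl hza)).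
by rewrite ltNge Eh.
Qed.

(** * Cocycles over a homeomorphism that is minimal on a compact set *)

Section cocycles.
Variables (R : realType) (X : topologicalType) (f g : X -> X) (K : set X).
Hypotheses (f_cont : continuous f) (g_cont : continuous g).
Hypotheses (fK : cancel f g) (gK : cancel g f).
Hypotheses (K_compact : compact K).
Hypotheses (Kf : forall z, K z -> K (f z)) (Kg : forall z, K z -> K (g z)).
Hypothesis K_minimal : minimal_on f K.

Definition cocycle k (S : nat -> X -> 'rV[R]_k) : Prop :=
  (forall n, continuous (S n)) /\
  forall m n z, S (m + n)%N z = S m z + S n (iter m f z).

(** Only an upper bound is asked, so as to obtain a cone; a lower bound is the same condition for
    [- v]. *)
Definition bounded_dir k (S : nat -> X -> 'rV[R]_k) (z : X) (v : 'rV[R]_k) :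
    Prop :=
  exists M : R, forall n, dotv (S n z) v <= M.

Let K_iterf n z : K z -> K (iter n f z).
Proof. by move=> Kz; elim: n => // n IH; exact: Kf. Qed.

Let K_iterg n z : K z -> K (iter n g z).
Proof. by move=> Kz; elim: n => // n IH; exact: Kg. Qed.

Lemma cocycle0 k (S : nat -> X -> 'rV[R]_k) z : cocycle S -> S 0%N z = 0.
Proof.
by move=> [_ /(_ 0%N 0%N z)/esym/eqP]; rewrite -subr_eq0 addrK => /eqP.
Qed.

Lemma cocycle_mulmx k m (S : nat -> X -> 'rV[R]_k) (N : 'M[R]_(k, m)) :
  cocycle S -> cocycle (fun n z => S n z *m N).
Proof.
move=> [cS SD]; split=> [n z|p n z]; last by rewrite SD mulmxDl.
apply/cvg_coord => i j; rewrite mxE; under eq_fun do rewrite mxE.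
apply: (@cvg_sumr _ _ (nbhs z) _) => l; apply: cvgM; last exact: cvg_cst.
by move: (cS n z) => /cvg_coord; exact.
Qed.

Lemma dotv_cocycle_continuous k (S : nat -> X -> 'rV[R]_k) n c :
  cocycle S -> continuous (fun z => dotv (S n z) c).
Proof.
by move=> [cS _] z; apply: (@cvg_dotv _ _ (nbhs z) _); [exact: cS|exact: cvg_cst].
Qed.

Lemma bounded_dir_iter k (S : nat -> X -> 'rV[R]_k) j z v :
  cocycle S -> bounded_dir S (iter j f z) v <-> bounded_dir S z v.
Proof.
move=> [_ SD]; split=> -[M SM].
  (* The first term serves the times from [j] on, the sum the earlier ones. *)
  exists (`|dotv (S j z) v + M| + \sum_(i < j) `|dotv (S i z) v|) => n.
  have [jn|nj] := leqP j n.
    rewrite -(subnKC jn) SD dotvDl ler_wpDr ?sumr_ge0//.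
    by rewrite (le_trans _ (ler_norm _))// lerD2l.
  rewrite ler_wpDl//; apply: le_trans (ler_norm _) _.
  by rewrite (bigD1 (Ordinal nj))//= ler_wpDr// sumr_ge0.
exists (M - dotv (S j z) v) => n.
by rewrite lerBrDr addrC -dotvDl -SD.
Qed.

Lemma bounded_dir_scale k (S : nat -> X -> 'rV[R]_k) z v s :
  0 < s -> bounded_dir S z (s *: v) -> bounded_dir S z v.
Proof.
move=> s0 [M SM]; exists (M / s) => n.
by rewrite ler_pdivlMr// mulrC -dotvZr.
Qed.

Lemma bounded_dir_cone k m (S : nat -> X -> 'rV[R]_k) z (A : 'M[R]_(m, k))
    (c : 'rV[R]_m) :
  (forall i, 0 <= c 0 i) -> (forall i, bounded_dir S z (row i A)) ->
  bounded_dir S z (c *m A).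
Proof.
move=> c0 /choice[M SM]; exists (\sum_i c 0 i * M i) => n.
by rewrite dotv_mulmxr; apply: ler_sum => i _; exact: ler_wpM2l.
Qed.

(** At points of [U m] every direction of [O] exceeds [m] at some time, an open condition because
    [O] is compact. Either all the [U m] are dense in [K], or some open set meeting [K] avoids one
    of them on [K]. *)
Lemma meagre_or_locally_bounded k (S : nat -> X -> 'rV[R]_k) (O : set 'rV[R]_k) :
  cocycle S -> compact O ->
  generically K (fun z => forall v, O v -> ~ bounded_dir S z v) \/
  exists M W, [/\ open W, K `&` W !=set0 &
    forall z, K z -> W z -> exists2 v, O v & forall n, dotv (S n z) v <= M].
Proof.
move=> [cS SD] cO.
pose U (m : nat) := [set z | forall v, O v -> exists n, m%:R < dotv (S n z) v].
have oU m : open (U m).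
  rewrite openE => z Uz.
  move/compact_near_coveringP : cO => /(_ X (nbhs z)
    (fun z v => exists n, m%:R < dotv (S n z) v)); apply => v Ov.
  have [n mn] := Uz v Ov.
  have cSv : dotv (S n p.2) p.1 @[p --> filter_prod (nbhs v) (nbhs z)] -->
      dotv (S n z) v.
    apply: cvg_dotv; last exact: cvg_fst.
    by apply: (@cvg_comp _ _ _ snd (S n) _ (nbhs z)); [exact: cvg_snd|exact: cS].
  move: (cSv _ (lt_nbhsr mn)).
  by apply: (@filterS _ (filter_prod (nbhs v) (nbhs z)) _) => p mp; exists n.
have [dU|/existsNP[m]] := pselect (forall m, K `<=` closure (K `&` U m)).
  left; exists U; split => // z Kz Uz v Ov [M SM].
  have [n] := Uz (Num.Def.truncn `|M|).+1 v Ov.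
  apply/negP; rewrite -leNgt (le_trans (SM n))// (le_trans (ler_norm M))//.
  by rewrite ltW// truncnS_gt.
move=> /existsNP[x /not_implyP[Kx /existsNP[B /not_implyP[+ BU]]]].
rewrite nbhsE => -[W [oW Wx] WB]; right; exists m%:R, W; split => //.
  by exists x.
move=> z Kz Wz; apply: contrapT => nv; apply: BU.
exists z; split; last exact: WB.
split => // v Ov; apply: contrapT => nn; apply: nv; exists v => // n.
by rewrite leNgt; apply/negP => mn; apply: nn; exists n.
Qed.

(** Zero-one law: every orbit in [K] meets [W], forward or backward in time, and bounded directions
    are constant along orbits. *)
Lemma meagre_or_bounded k (S : nat -> X -> 'rV[R]_k) (O : set 'rV[R]_k) :
  cocycle S -> compact O ->
  generically K (fun z => forall v, O v -> ~ bounded_dir S z v) \/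
  forall z, K z -> exists2 v, O v & bounded_dir S z v.
Proof.
move=> cS cO; have [|[M [W [oW [x [Kx Wx]] SM]]]] := meagre_or_locally_bounded cS cO.
  by left.
right=> z Kz; have [w [[j zw] Ww]] := K_minimal Kz Kx (open_nbhs_nbhs (conj oW Wx)).
case: zw => [wE|zE].
  have [|v Ov Sv] := SM w _ Ww; first by rewrite wE; exact: K_iterf.
  by exists v => //; apply/(bounded_dir_iter j _ _ cS); rewrite -wE; exists M.
have [|v Ov Sv] := SM w _ Ww.
  by rewrite -(iter_cancel j fK w) -zE; exact: K_iterg.
by exists v => //; rewrite zE; apply/bounded_dir_iter => //; exists M.
Qed.

(** Each point of [K] enters [W] after finitely many forward or backward steps. By continuity the
    same number of steps serves a neighbourhood, and compactness of [K] makes the local bounds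
    uniform. *)
Lemma locally_bounded_uniform k (S : nat -> X -> 'rV[R]_k) c M (W : set X) :
  cocycle S -> open W -> K `&` W !=set0 ->
  (forall z, K z -> W z -> forall n, dotv (S n z) c <= M) ->
  exists M', forall z, K z -> forall n, dotv (S n z) c <= M'.
Proof.
move=> cS oW [x [Kx Wx]] SM; pose D n z := dotv (S n z) c.
have cD n : continuous (D n) by exact: dotv_cocycle_continuous.
have DD m n z : D (m + n)%N z = D m z + D n (iter m f z).
  by rewrite /D cS.2 dotvDl.
suff : \forall N \near \oo, K `<=` [set z | forall n, D n z <= N%:R].
  by move=> [N _ NP]; exists N%:R => z Kz; exact: (NP N (leqnn _)).
move: K_compact => /compact_near_coveringP/near_covering_withinP; apply => y Ky.
suff [B [b [yB Bb]]] : exists B b, nbhs y B /\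
    forall y', K y' -> B y' -> forall n, D n y' <= b.
  exists (B, [set N | b <= N%:R]); first by split => //; exact: nbhs_infty_ger.
  by move=> [y' N] [/= By' bN] Ky' n; apply: le_trans bN; exact: Bb.
have [w [[j yw] Ww]] := K_minimal Ky Kx (open_nbhs_nbhs (conj oW Wx)).
case: yw => [wE|yE].
  exists [set y' | W (iter j f y') /\ forall i : 'I_j.+1, D i y' < D i y + 1].
  exists (\sum_(i < j.+1) (`|D i y| + 1) + `|M|); split.
    apply: (@filterI _ (nbhs y) _ (iter j f @^-1` W)
      [set y' | forall i : 'I_j.+1, D i y' < D i y + 1]).
      have yW : nbhs (iter j f y) W by apply: open_nbhs_nbhs; split; rewrite -?wE.
      exact: (iter_continuous f_cont yW).
    apply: (@filter_forall _ _ (fun (i : 'I_j.+1) y' => D i y' < D i y + 1) (nbhs y)) => i.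
    have Di : D i y < D i y + 1 by rewrite ltrDl.
    exact: (cD i y _ (lt_nbhsl Di)).
  move=> y' Ky' [Wy' Dy'] n.
  have Di i : (i <= j)%N -> D i y' <= \sum_(i < j.+1) (`|D i y| + 1).
    rewrite -ltnS => ij; apply: le_trans (ltW (Dy' (Ordinal ij))) _.
    rewrite (bigD1 (Ordinal ij))//= ler_wpDr// ?lerD2r ?ler_norm//.
    by apply: sumr_ge0 => l _; rewrite addr_ge0.
  have [jn|/ltnW nj] := leqP j n; last by rewrite ler_wpDr// Di.
  rewrite -(subnKC jn) DD lerD ?Di//; apply: le_trans (ler_norm M).
  by apply: SM => //; exact: K_iterf.
have wE : w = iter j g y by rewrite yE iter_cancel.
(* Backward entry: a sum from [y'] is a sum from [iter j g y'], at most [M], minus its first [j]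
   steps, more than [D j w - 1]. *)
exists [set y' | W (iter j g y') /\ D j w - 1 < D j (iter j g y')].
exists (M - (D j w - 1)); split.
  apply: (@filterI _ (nbhs y) _ (iter j g @^-1` W)
    (iter j g @^-1` [set y' | D j w - 1 < D j y'])).
    have yW : nbhs (iter j g y) W by apply: open_nbhs_nbhs; split; rewrite -?wE.
    exact: (iter_continuous g_cont yW).
  have Djw : D j w - 1 < D j w by rewrite ltrBlDr ltrDl.
  have yD : nbhs (iter j g y) [set y' | D j w - 1 < D j y'].
    by rewrite -wE; exact: (cD j w _ (lt_nbhsr Djw)).
  exact: (iter_continuous g_cont yD).
move=> y' Ky' [Wy' Dy'] n.
have /eqP := DD j n (iter j g y'); rewrite (iter_cancel j gK) addrC -subr_eq => /eqP <-.
by apply: lerB; [apply: SM => //; exact: K_iterg|exact: ltW].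
Qed.

(* A uniform one-sided bound together with the absence of drift yields points
   whose sums are bounded on arbitrarily long two-sided windows; a cluster point
   of these has a bounded two-sided orbit, as in Gottschalk-Hedlund. *)
Lemma generically_unbounded k (S : nat -> X -> 'rV[R]_k) c :
  cocycle S ->
  (forall n, exists2 z, K z & 0 <= dotv (S n z) c) ->
  (forall M, exists n z, K z /\ M < `|dotv (S n z) c|) ->
  generically K (fun z => ~ bounded_dir S z c).
Proof.
move=> cS S_ge0 S_unbounded; pose D n z := dotv (S n z) c.
have cD n : continuous (D n) by exact: dotv_cocycle_continuous.
have DD m n z : D (m + n)%N z = D m z + D n (iter m f z).
  by rewrite /D cS.2 dotvDl.
have [gS|[M0 [W [oW W0 SM0]]]] := meagre_or_locally_bounded cS (@compact_set1 _ c).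
  by apply: generically_sub gS => z _; exact.
have [z Kz Wz n|M DM] := @locally_bounded_uniform k S c M0 W cS oW W0.
  by have [_ ->] := SM0 z Kz Wz.
exfalso.
(* Time [n + n] leaves a window of length [n] on either side of the midpoint [iter n f (y n)]. *)
have /choice[y yP] : forall n, exists y, K y /\ 0 <= D (n + n)%N y.
  by move=> n; have [y] := S_ge0 (n + n)%N; exists y.
have D_ge n a : (a <= n + n)%N -> - M <= D a (y n).
  move=> an; have [Ky] := yP n; rewrite -(subnKC an) DD.
  by have := DM _ (K_iterf a Ky) (n + n - a)%N; rewrite -/(D _ _); lra.
have [x [Kx cx]] : K `&` cluster ((fun n => iter n f (y n)) @ \oo) !=set0.
  by apply: K_compact; exists 0%N => // n _; apply: K_iterf; have [] := yP n.
(* The inequality is closed, so it is checked at the midpoints accumulating at [x]; there the sum is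
   a difference of two sums starting from [y n]. *)
have Dg j l : - M - M <= D l (iter j g x).
  apply: (@ge_closure _ _ (fun x => D l (iter j g x))
    [set w | exists n, [/\ w = iter n f (y n), j <= n & l <= n]%N]).
  - move=> x'; apply: (@cvg_comp _ _ _ _ (D l) _ (nbhs (iter j g x'))).
      exact: iter_continuous.
    exact: cD.
  - move=> _ [n [-> jn ln]].
    have [Ky _] := yP n.
    rewrite -{1}(subnKC jn) iterD iter_cancel//.
    have nj : (n - j <= n + n)%N by rewrite (leq_trans (leq_subr _ _))// leq_addr.
    have njl : (n - j + l <= n + n)%N by rewrite leq_add// leq_subr.
    have := D_ge n _ njl; rewrite DD.
    by have := DM _ Ky (n - j)%N; rewrite -/(D _ _); lra.
  - move: cx; rewrite clusterE; apply; exists (maxn j l) => // n /=.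
    by rewrite geq_max => /andP[jn ln]; exists n.
(* The orbit of [x] is dense in [K], so its lower bounds pass to all of [K]. *)
have Dall z l : K z -> - M - M - M <= D l z.
  move=> Kz; apply: (ge_closure (cD l) _ (K_minimal Kx Kz)) => w [i [->|xE]].
    have := Dg 0%N (i + l)%N; rewrite DD /=.
    by have := DM _ Kx i; rewrite -/(D _ _); lra.
  have -> : w = iter i g x by rewrite xE iter_cancel.
  by have := Dg i l; have := DM _ Kx 0%N; rewrite cocycle0// dotvE mul0mx mxE; lra.
have [n [z [Kz]]] := S_unbounded (M + M + M).
apply/negP; rewrite -leNgt ler_norml.
have := Dall z n Kz; have := DM z Kz n; rewrite -/(D n z).
have := DM _ Kz 0%N; rewrite cocycle0// dotvE mul0mx mxE; lra.
Qed.

(** The closed cone [T]: the intersection over [K] of the closures of the cones of bounded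
    directions. *)
Definition essential_dir k (S : nat -> X -> 'rV[R]_k) (v : 'rV[R]_k) : Prop :=
  forall e : R, 0 < e -> forall z, K z ->
    exists2 w : 'rV[R]_k, (forall i, `|w 0 i - v 0 i| <= e) & bounded_dir S z w.

(** If a bounded direction [v] is not essential, some box around it has no bounded direction at some
    point, hence generically none. The same then holds for a rational box containing [v], and there
    are only countably many of these. *)
Lemma bounded_dir_essential k (S : nat -> X -> 'rV[R]_k) : cocycle S ->
  generically K (fun z => forall v, bounded_dir S z v -> essential_dir S v).
Proof.
move=> cS.
pose box (p : 'rV[rat]_k * nat) :=
  [set w : 'rV[R]_k | forall i, `|w 0 i - ratr (p.1 0 i)| <= p.2.+1%:R^-1].
pose free p z := forall v, box p v -> ~ bounded_dir S z v.
(* The implication is vacuous for boxes that are not generically free, so it can be intersected over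
   all boxes. *)
have : forall p, generically K (fun z => generically K (free p) -> free p z).
  move=> p; have [gp|ngp] := pselect (generically K (free p)).
    by apply: generically_sub gp.
  exact: generically_all.
move=> /generically_forall; apply: generically_sub => z Kz boxz v bv e e0.
apply: contrapT => ne.
have [n nP] : exists n : nat, 2 * n.+1%:R^-1 < e.
  exists (Num.Def.truncn (2 / e)); rewrite ltr_pdivrMr// mulrC.
  by rewrite -ltr_pdivrMr// truncnS_gt.
have n0 : 0 < n.+1%:R^-1 :> R by rewrite invr_gt0.
have [q qv] := rat_approx v n0.
have vq : box (q, n) v by move=> i /=; rewrite distrC.
apply: (boxz (q, n) _ v vq bv).
have [|ev] := meagre_or_bounded cS (@box_compact R k v e).
  apply: generically_sub => z' Kz' ze w qw; apply: ze => i /=.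
  have := qw i; have := qv i; rewrite /= => q1 q2.
  apply: le_trans (ler_distD (ratr (q 0 i)) _ _) _.
  apply: le_trans (lerD q2 q1) _; move: nP; set a := _^-1 => /ltW.
  by rewrite mulr_natl mulr2n.
by exfalso; apply: ne.
Qed.

(** An essential direction outside the span could be appended to [N] as a further independent row,
    against maximality. *)
Lemma essential_dir_sub k (S : nat -> X -> 'rV[R]_k) m (N : 'M[R]_(m, k)) :
  (forall p (N' : 'M[R]_(p, k)), row_free N' ->
    (forall i, essential_dir S (row i N')) -> (p <= m)%N) ->
  row_free N -> (forall i, essential_dir S (row i N)) ->
  forall v, essential_dir S v -> (v <= N)%MS.
Proof.
move=> maxm fN eN v ev; apply/negPn/negP => vN.
have : (1 + m <= m)%N.
  apply: (maxm _ (col_mx v N)).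
    have : (\rank N < \rank (col_mx v N))%N.
      apply: rank_ltmx; rewrite /ltmx -!addsmxE addsmxSr /= addsmx_sub negb_and.
      by rewrite vN.
    by rewrite (eqP fN) /row_free eqn_leq rank_leq_row.
  move=> i; rewrite -(splitK i); case: (fintype.split i) => j /=.
    by rewrite rowKu row_id.
  by rewrite rowKd.
by rewrite add1n ltnn.
Qed.

(* If the essential directions span, they contain a basis, and every z has the
   sum of this basis as a bounded direction; this contradicts the assumption
   for that fixed direction. Otherwise bounded directions generically lie in
   the proper subspace spanned by the essential ones: use induction. *)
Lemma generically_unbounded_all k (S : nat -> X -> 'rV[R]_k) :
  cocycle S ->
  (forall c : 'rV[R]_k, c != 0 ->
    generically K (fun z => ~ bounded_dir S z c)) ->
  generically K (fun z => forall c : 'rV[R]_k, c != 0 -> ~ bounded_dir S z c).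
Proof.
elim/ltn_ind: k S => k IH S cS Sc.
have [k0|k0] := posnP k.
  apply: generically_all => z _ c /negP[]; apply/eqP/rowP => i.
  by have := ltn_ord i; rewrite {2}k0.
pose P m := `[< exists2 N : 'M[R]_(m, k), row_free N &
  forall i, essential_dir S (row i N) >].
have P0 : exists m, P m.
  exists 0%N; apply/asboolP; exists 0; last by case.
  by rewrite /row_free mxrank0.
have Pk m : P m -> (m <= k)%N.
  by move=> /asboolP[N fN _]; rewrite -(eqP fN) rank_leq_col.
case: (ex_maxnP P0 Pk) => m /asboolP[N fN eN] maxm.
have [km|mk] := leqP k m.
  have mkE : m = k.
    by apply/eqP; rewrite eqn_leq km andbT -(eqP fN) rank_leq_col.
  move: N fN eN; rewrite mkE => N fN eN {P0 Pk maxm km mkE}.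
  have uN : N \in unitmx by rewrite -row_free_unit.
  have [e e0 eP] := unitmx_row_cone uN.
  pose v : 'rV[R]_k := const_mx 1 *m N.
  have v0 : v != 0.
    apply/eqP => vE; have /rowP/(_ (Ordinal k0)) : const_mx 1 = 0 :> 'rV[R]_k.
      by rewrite -(mulmxK uN (const_mx 1)) -/v vE mul0mx.
    by rewrite !mxE => /eqP; rewrite oner_eq0.
  apply: generically_sub (Sc v v0) => z Kz [].
  have /choice[w wP] : forall i, exists w : 'rV[R]_k,
      (forall j, `|w 0 j - N i j| < e) /\ bounded_dir S z w.
    move=> i; have [|w wN bw] := eN i (e / 2) _ z Kz; first by rewrite divr_gt0.
    exists w; split => // j; have := wN j; rewrite mxE => /le_lt_trans; apply.
    by rewrite gtr_pMr// invf_lt1// ltr1n.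
  have [|c c0 [s s0 cA]] := eP (\matrix_i w i).
    by move=> i j; rewrite mxE; exact: (wP i).1.
  apply: (bounded_dir_scale s0); rewrite -cA; apply: bounded_dir_cone => // i.
  by rewrite rowK; exact: (wP i).2.
(* Projection to the span of the rows of [N]: direction [c] of the new cocycle is direction [c *m N]
   of [S]. *)
have cSN : cocycle (fun n z => S n z *m N^T) by exact: cocycle_mulmx.
have bSN z c : bounded_dir (fun n z => S n z *m N^T) z c <->
    bounded_dir S z (c *m N).
  by split=> -[M SM]; exists M => n; have := SM n; rewrite dotv_mulmx.
have Nc0 (c : 'rV[R]_m) : c != 0 -> c *m N != 0.
  by apply: contra => /eqP cN; apply/eqP/(row_free_inj fN); rewrite mul0mx.
have gN := IH m mk _ cSN.
have {}gN : generically K (fun z => forall c : 'rV[R]_m, c != 0 ->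
    ~ bounded_dir (fun n z => S n z *m N^T) z c).
  apply: gN => c c0; have := Sc _ (Nc0 c c0).
  by apply: generically_sub => z _ nb /bSN.
have := generically_and gN (bounded_dir_essential cS).
apply: generically_sub => z Kz [gNz ez] c c0 bc.
have /submxP[w cE] : (c <= N)%MS.
  apply: (@essential_dir_sub _ S) (ez c bc) => // p N' fN' eN'.
  by apply: maxm; apply/asboolP; exists N'.
apply: (gNz w); last by apply/bSN; rewrite -cE.
by apply: contraNneq c0 => w0; rewrite cE w0 mul0mx.
Qed.

End cocycles.

(** * The torus: separation, compactness, local differences *)

Section torus_topology.
Variables (R : realType) (d : nat).
Local Notation torus := (torus R d).
Implicit Types (x y : 'rV[R]_d) (a b z : torus).

(** The saturation of an open set is a union of integer translates of it, hence open. *)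
Lemma torus_pi_image_nbhs x (W : set 'rV[R]_d) :
  nbhs x W -> nbhs (torus_pi x) (@torus_pi R d @` W).
Proof.
move=> xW; pose U := W°; have Ux : U x by [].
have oU : open U by exact: open_interior.
have UW : U `<=` W by exact: interior_subset.
apply: (@filterS _ (nbhs (torus_pi x)) _ (@torus_pi R d @` U)).
  by move=> _ [u Uu <-]; exists u => //; exact: UW.
suff : open (@torus_pi R d @^-1` (@torus_pi R d @` U)).
  move=> oU'; apply: (@open_nbhs_nbhs torus (torus_pi x) (@torus_pi R d @` U)).
  by split => //; exists x.
rewrite openE => y [u Uu uy].
have cty : continuous (fun y' : 'rV[R]_d => y' + (u - y)).
  by move=> y'; apply: (@cvgD _ _ _ (nbhs y') _); [exact: cvg_id|exact: cvg_cst].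
have Uy : nbhs (y + (u - y)) U by rewrite subrKC; exact: open_nbhs_nbhs.
apply: (@filterS _ (nbhs y) _ _ _ _ (cty y _ Uy)) => y' /= Uy'.
exists (y' + (u - y)) => //; apply/torus_piP => i.
by rewrite !mxE addrAC subrr add0r; move/torus_piP: uy; exact.
Qed.

Lemma torus_pi_box x (e : R) : 0 < e ->
  nbhs (torus_pi x) (@torus_pi R d @` [set y : 'rV[R]_d | forall i, `|y 0 i - x 0 i| < e]).
Proof.
move=> e0; apply: torus_pi_image_nbhs; apply/nbhs_ballP; exists e => //= y [_ xy] i.
by have := xy 0 i; rewrite -ball_normE /ball_ /= distrC.
Qed.

(** At most one integer is closer than 1/2 to [t]; take its distance, or 1/2 if there is none. *)
Lemma int_gap (t : R) : t \isn't a Num.int ->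
  exists2 e : R, 0 < e & forall s, s \is a Num.int -> e <= `|s - t|.
Proof.
move=> tZ.
have [[s0 s0Z s0t]|ns] := pselect (exists2 s, s \is a Num.int & `|s - t| < 2^-1).
  exists `|s0 - t| => [|s sZ].
    by rewrite normr_gt0 subr_eq0; apply: contraNneq tZ => <-.
  have [->//|ss0] := eqVneq s s0.
  have := @norm_intr_ge1 R (s - s0) (rpredB sZ s0Z); rewrite subr_eq0 => /(_ ss0) h.
  have := ler_distD t s s0; rewrite (distrC t); lra.
exists 2^-1 => [|s sZ]; first by rewrite invr_gt0.
by rewrite leNgt; apply/negP => st; apply: ns; exists s.
Qed.

Lemma torus_hausdorff : hausdorff_space torus.
Proof.
move=> p q; rewrite -(torus_reprK p) -(torus_reprK q).
set x := torus_repr p; set y := torus_repr q => pq.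
apply/torus_piP => i; apply: contrapT => /negP xy.
(* Boxes of radius [e / 2] have disjoint images: a common point would put an integer closer than [e]
   to [x 0 i - y 0 i]. *)
have [e e0 eP] := int_gap xy.
have e20 : 0 < e / 2 by rewrite divr_gt0.
have [_ [[x' xx' <-] [y' yy' xy']]] := pq _ _ (torus_pi_box x e20) (torus_pi_box y e20).
have := eP (y' 0 i - x' 0 i); have := xx' i; have := yy' i.
have /torus_piP/(_ i) -> := xy'.
have := eP (- (y' 0 i - x' 0 i)); rewrite rpredN; have /torus_piP/(_ i) -> := xy'.
move=> /(_ isT) h1 h2 h3 _; move: h1.
have -> : - (y' 0 i - x' 0 i) - (x 0 i - y 0 i) =
  (x' 0 i - x 0 i) - (y' 0 i - y 0 i) by ring.
apply/negP; rewrite -ltNge (le_lt_trans (ler_normB _ _))//; lra.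
Qed.

Lemma torus_compact : compact [set: torus].
Proof.
have cI : compact [set v : 'rV[R]_d | forall i, `[0, 1]%classic (v ord0 i)].
  apply: (@rV_compact R d (fun=> `[0, 1]%classic)) => i; exact: segment_compact.
have := continuous_compact (continuous_subspaceT (@torus_pi_continuous R d)) cI.
congr compact; apply/seteqP; split=> // z _.
pose x := torus_repr z; exists (\row_i (x 0 i - (Num.floor (x 0 i))%:~R)).
  move=> i; rewrite mxE /= in_itv /= subr_ge0 ge_floor /=.
  by rewrite lerBlDl ltW// -[X in _ + X]/(1%:~R) -intrD floorD1_gt.
rewrite -(torus_reprK z) -/x; apply/torus_piP => i; rewrite mxE addrAC subrr add0r.
by rewrite rpredN intr_int.
Qed.

(* The representative of t modulo 1 in [-1/2, 1/2[. *)
Definition centered (t : R) : R := t - (Num.floor (t + 2^-1))%:~R.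

Lemma centered_int t : centered t - t \is a Num.int.
Proof. by rewrite /centered addrAC subrr add0r rpredN intr_int. Qed.

Lemma centeredDint t s : s \is a Num.int -> centered (t + s) = centered t.
Proof.
by move=> sZ; rewrite /centered (addrAC t s 2^-1) floorDrz// intrD (floorK sZ); ring.
Qed.

Lemma centered_id t : `|t| < 2^-1 -> centered t = t.
Proof.
rewrite ltr_norml => t2; rewrite /centered (@floor_def _ _ 0) ?subr0//.
by rewrite add0r mulr0z mulr1z; lra.
Qed.

(** A lift of [a - b] that does not depend on representatives; it jumps where a coordinate reaches
    1/2, whence [torus_close]. *)
Definition torus_diff a b : 'rV[R]_d :=
  \row_i centered (torus_repr a 0 i - torus_repr b 0 i).

Lemma torus_diff_pi x y i :
  torus_diff (torus_pi x) (torus_pi y) 0 i = centered (x 0 i - y 0 i).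
Proof.
rewrite mxE.
have /torus_piP/(_ i) xZ := torus_reprK (torus_pi x).
have /torus_piP/(_ i) yZ := torus_reprK (torus_pi y).
rewrite -(centeredDint (x 0 i - y 0 i) (rpredB xZ yZ)); congr centered; ring.
Qed.

Lemma torus_piD_diff a y : torus_pi (y + torus_diff a (torus_pi y)) = a.
Proof.
rewrite -{2}(torus_reprK a); apply/torus_piP => i.
rewrite mxE -{1}(torus_reprK a) torus_diff_pi.
rewrite [X in X \is a _](_ : _ = centered (torus_repr a 0 i - y 0 i) - (torus_repr a 0 i - y 0 i)).
  exact: centered_int.
ring.
Qed.

Definition torus_close a b : Prop := exists x y,
  [/\ torus_pi x = a, torus_pi y = b & forall i, `|x 0 i - y 0 i| < 4^-1].

Lemma torus_diff_cvg a b : torus_close a b ->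
  torus_diff p.1 p.2 @[p --> (a, b)] --> torus_diff a b.
Proof.
move=> [x [y [<- <- xy]]]; apply/cvg_coord => i0 i; rewrite ord1 torus_diff_pi.
apply/cvgrPdist_lt => e e0.
(* As 1/4 + 1/8 + 1/8 = 1/2, perturbed differences stay where [centered] is the identity. *)
pose e' := Num.min (e / 2) 8^-1.
have e'0 : 0 < e' by rewrite lt_min divr_gt0// invr_gt0 /=.
exists (@torus_pi R d @` [set y : 'rV[R]_d | forall i, `|y 0 i - x 0 i| < e'],
  @torus_pi R d @` [set y' : 'rV[R]_d | forall i, `|y' 0 i - y 0 i| < e']).
  by split; exact: torus_pi_box.
move=> [_ _] [/= [x' xx' <-] [y' yy' <-]]; rewrite torus_diff_pi.
have := xx' i; have := yy' i; have := xy i; rewrite !lt_min => xyi.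
move=> /andP[+ +] /andP[]; rewrite !ltr_norml => y1 y2 x1 x2.
move: xyi; rewrite ltr_norml => xyi.
have xy2 : `|x 0 i - y 0 i| < 2^-1 by rewrite ltr_norml; lra.
have xy2' : `|x' 0 i - y' 0 i| < 2^-1 by rewrite ltr_norml; lra.
by rewrite !centered_id//; lra.
Qed.

End torus_topology.

(** * Lifts of maps homotopic to the identity *)

Lemma continuous_int_constant (R : realType) d (h : 'rV[R]_d -> R) :
  continuous h -> (forall x, h x \is a Num.int) -> forall x y, h x = h y.
Proof.
move=> ch hZ x y; apply/eqP; apply: contrapT => /negP hxy.
wlog lt_hxy : x y hxy / h x < h y.
  move=> W; have [|yx|/eqP] := ltgtP (h x) (h y); last by rewrite (negbTE hxy).
    exact: W.
  by apply: (W y x) => //; rewrite eq_sym.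
pose u (t : R) := h (x + t *: (y - x)).
have cu : continuous u.
  move=> t; apply: (@cvg_comp _ _ _ (fun t => x + t *: (y - x)) h _
    (nbhs (x + t *: (y - x)))); last exact: ch.
  by apply: cvgD; [exact: cvg_cst|apply: cvgZr_tmp; exact: cvg_id].
have u0 : u 0 = h x by rewrite /u scale0r addr0.
have u1 : u 1 = h y by rewrite /u scale1r subrKC.
have h1 : 1 <= h y - h x.
  rewrite -[h y - h x]ger0_norm; last by rewrite subr_ge0 ltW.
  by apply: norm_intr_ge1; [exact: rpredB|rewrite subr_eq0 eq_sym].
(* The value [h x + 2^-1], which is not an integer, would be attained on the segment. *)
have [||c _ uc] := @IVT R u 0 1 (h x + 2^-1) ler01.
- exact: continuous_subspaceT.
- by rewrite u0 u1 ge_min le_max; apply/andP; split; apply/orP; [left|right]; lra.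
have := @norm_intr_ge1 R (u c - h x) (rpredB (hZ _) (hZ _)).
rewrite uc addrAC subrr add0r invr_eq0 pnatr_eq0 /= => /(_ isT).
by rewrite ger0_norm ?invr_ge0//; lra.
Qed.

Section homotopic_to_identity.
Variables (R : realType) (d : nat).
Local Notation torus := (torus R d).
Local Notation cylinder := (`[0, 1] `*` [set: torus] : set (R * torus)).

Lemma homotopy_slice_continuous (H : R * torus -> torus) t :
  {within cylinder, continuous H} -> `[0, 1]%classic t ->
  continuous (fun z => H (t, z)).
Proof.
move=> /subspace_continuousP cH t01 z.
apply: (@cvg_comp _ _ _ (fun z => (t, z)) H _ (within cylinder (nbhs (t, z)))).
  move=> B [[A1 A2] /= [/nbhs_singleton tA1 zA2] AB].
  apply: (@filterS _ (nbhs z) _ _ _ _ zA2) => z' A2z'.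
  exact: (AB (t, z') (conj tA1 A2z') (conj t01 I)).
exact: (cH (t, z) (conj t01 I)).
Qed.

(** Compactness of the cylinder gives one mesh for all points, with which the homotopy is cut into
    short steps. *)
Lemma homotopy_uniformly_close (H : R * torus -> torus) :
  {within cylinder, continuous H} ->
  exists N : nat, forall (s t : R) z, `[0, 1]%classic s -> `[0, 1]%classic t ->
    `|s - t| <= N.+1%:R^-1 -> torus_close (H (s, z)) (H (t, z)).
Proof.
move=> /subspace_continuousP cH.
have cC : compact cylinder.
  by apply: compact_setX; [exact: segment_compact|exact: torus_compact].
suff : \forall N \near \oo, cylinder `<=` [set p | forall s, `[0, 1]%classic s ->
    `|s - p.1| <= N.+1%:R^-1 -> torus_close (H (s, p.2)) (H p)].
  move=> [N _ NP]; exists N => s t z s01 t01.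
  exact: (NP N (leqnn _) (t, z) (conj t01 I)).
move: cC => /compact_near_coveringP/near_covering_withinP; apply => -[t z] Ctz.
pose x := torus_repr (H (t, z)).
(* Two points within 1/8 of [x] are within 1/4 of each other. *)
have e80 : 0 < 8^-1 :> R by rewrite invr_gt0.
have := torus_pi_box x e80; rewrite torus_reprK => /(cH _ Ctz).
move=> [[A B] /= [/nbhs_ballP[e /= e0 eA] zB] AB].
have e20 : 0 < e / 2 by rewrite divr_gt0.
exists (ball t (e / 2) `*` B, [set N | N.+1%:R^-1 < e / 2]).
  split; last exact: (near_infty_natSinv_lt (PosNum e20)).
  by exists (ball t (e / 2), B) => //; split => //; exact: nbhsx_ballx.
move=> [[t' z'] N] [/= [tt' Bz'] Ne] [/= t'01 _] s s01 st'.
have [] := AB (t', z').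
- by split => //=; apply: eA; apply: le_ball tt'; rewrite ler_pdivrMr// ler_pMr// ler1n.
- by split.
move=> x1 xx1 x1E.
have [] := AB (s, z').
- split => //=; apply: eA; rewrite -ball_normE /ball_ /=.
  rewrite (le_lt_trans (ler_distD t' _ _))// [e]splitr ltrD//.
  by rewrite distrC (le_lt_trans st').
- by split.
move=> x2 xx2 x2E; exists x2, x1; split => // i.
have := xx1 i; have := xx2 i; rewrite !ltr_norml; lra.
Qed.

(** Adding the differences over short steps of the homotopy gives a continuous [phi0] and thereby a
    lift of [f]. It differs from [F] by a continuous integer-valued, hence constant, function. *)
Lemma lift_displacement (f : torus -> torus) (F : 'rV[R]_d -> 'rV[R]_d) :
  Homeo0 f -> is_lift f F ->
  exists2 phi : torus -> 'rV[R]_d, continuous phi &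
    forall x, F x = x + phi (torus_pi x).
Proof.
move=> [_ [H [cH H0 H1]]] [cF piF].
have [N closeH] := homotopy_uniformly_close cH.
(* Time runs from 1 down to 0, since [H] is the identity at time 1 and [f] at time 0. *)
pose t (j : nat) : R := 1 - j%:R / N.+1%:R.
have t01 j : (j <= N.+1)%N -> `[0, 1]%classic (t j).
  move=> jN; rewrite /= in_itv /= /t subr_ge0 gerBl divr_ge0// andbT.
  by rewrite ler_pdivrMr// mul1r ler_nat.
have tS j : `|t j.+1 - t j| <= N.+1%:R^-1.
  rewrite /t (_ : _ - _ = - N.+1%:R^-1); first by rewrite normrN ger0_norm// invr_ge0.
  have : N.+1%:R != 0 :> R by rewrite pnatr_eq0.
  by rewrite -[j.+1%:R]natr1; move: (N.+1%:R) => n n0; field.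
pose phi0 z : 'rV[R]_d :=
  \sum_(j < N.+1) torus_diff (H (t j.+1, z)) (H (t j, z)).
have cphi0 : continuous phi0.
  move=> z; apply/(@cvg_coord _ _ (nbhs z) _) => i0 i; rewrite summxE.
  under eq_fun do rewrite summxE.
  apply: (@cvg_sumr _ _ (nbhs z) _) => j.
  have : torus_diff (H (t j.+1, z')) (H (t j, z')) @[z' --> z] -->
      torus_diff (H (t j.+1, z)) (H (t j, z)).
    apply: (@cvg_comp _ _ _ (fun z => (H (t j.+1, z), H (t j, z)))
      (fun p => torus_diff p.1 p.2) _ (nbhs (H (t j.+1, z), H (t j, z)))).
      apply: (@cvg_pair _ _ _ (nbhs z) (nbhs (H (t j.+1, z))) (nbhs (H (t j, z))));
        apply: (homotopy_slice_continuous cH); apply: t01 => //.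
      exact: ltnW.
    apply: torus_diff_cvg; apply: closeH; [exact: t01| |exact: tS].
    by apply: t01; exact: ltnW.
  by move/cvg_coord; exact.
have piphi0 x : torus_pi (x + phi0 (torus_pi x)) = f (torus_pi x).
  suff P m : (m <= N.+1)%N -> torus_pi (x +
      \sum_(j < m) torus_diff (H (t j.+1, torus_pi x)) (H (t j, torus_pi x))) =
      H (t m, torus_pi x).
    by rewrite P// /t divff ?subrr ?H0// pnatr_eq0.
  elim: m => [_|m IH mN]; first by rewrite big_ord0 addr0 /t mul0r subr0 H1.
  by rewrite big_ord_recr /= addrA -(IH (ltnW mN)) torus_piD_diff.
pose h x := F x - (x + phi0 (torus_pi x)).
have hZ x i : h x 0 i \is a Num.int.
  have /torus_piP/(_ i) : torus_pi (F x) = torus_pi (x + phi0 (torus_pi x)).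
    by rewrite piF piphi0.
  by rewrite /h !mxE.
have ch : continuous h.
  move=> x; apply: (@cvgB _ _ _ (nbhs x) _); first exact: cF.
  apply: (@cvgD _ _ _ (nbhs x) _); first exact: cvg_id.
  apply: (@cvg_comp _ _ _ (@torus_pi R d) phi0 _ (nbhs (torus_pi x))).
    exact: torus_pi_continuous.
  exact: cphi0.
have h_cst x : h x = h 0.
  apply/rowP => i; apply: (@continuous_int_constant R d (fun x => h x 0 i)) => //.
  by move=> y; have /cvg_coord := ch y; exact.
exists (fun z => phi0 z + h 0).
  by move=> z; apply: (@cvgD _ _ _ (nbhs z) _); [exact: cphi0|exact: cvg_cst].
by move=> x; rewrite -(h_cst x) addrA /h addrC subrK.
Qed.

Lemma displacement_sum (f : torus -> torus) F phi :
  is_lift f F -> (forall x, F x = x + phi (torus_pi x)) ->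
  forall n z, displacement F n z = \sum_(j < n) phi (iter j f z).
Proof.
move=> [_ piF] Fphi n z; rewrite /displacement.
have piFn m x : torus_pi (iter m F x) = iter m f (torus_pi x).
  by elim: m => //= m <-; rewrite piF.
elim: n => [|n IH]; first by rewrite big_ord0 subrr.
by rewrite big_ord_recr /= -IH Fphi piFn torus_reprK addrAC.
Qed.

End homotopic_to_identity.

(** * Rotation vectors and the deviation cocycle *)

Lemma rV_bounded_subsequence (R : realType) d (u : nat -> 'rV[R]_d) (C : R) :
  (forall n i, `|u n 0 i| <= C) ->
  exists2 p : nat -> nat, increasing_seq p &
    exists r : 'rV[R]_d, u (p n) @[n --> \oo] --> r.
Proof.
move=> uC.
have [r [_ ur]] : [set w : 'rV[R]_d | forall i, `|w 0 i - (0 : 'rV[R]_d) 0 i| <= C]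
    `&` cluster (u @ \oo) !=set0.
  by apply: box_compact; exists 0%N => // n _ i /=; rewrite mxE subr0.
(* Bolzano-Weierstrass: [next] gives an index beyond the previous one at which [u] is close to the
   cluster point [r]. *)
have /choice[next nextP] : forall q : nat * nat, exists n,
    (q.2 < n)%N /\ forall i, `|u n 0 i - r 0 i| < q.1.+1%:R^-1.
  move=> [m l] /=.
  have m0 : 0 < m.+1%:R^-1 :> R by rewrite invr_gt0.
  have rB : nbhs r (ball r (m.+1%:R^-1 : R)) by exact: nbhsx_ballx.
  have uA : (u @ \oo) [set w | exists2 n, (l < n)%N & w = u n].
    by exists l.+1 => // n /= ln; exists n.
  have [_ [[n ln ->] [_ nB]]] := ur _ _ uA rB.
  by exists n; split => // i; have := nB 0 i; rewrite -ball_normE /ball_ /= distrC.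
pose p := fix p n := if n is m.+1 then next (m.+1, p m) else next (0%N, 0%N).
exists p; first by apply/increasing_seqP => n /=; exact: (nextP (n.+1, p n)).1.
have pP n i : `|u (p n) 0 i - r 0 i| < n.+1%:R^-1.
  by case: n => [|n]; [exact: (nextP (0, 0)%N).2|exact: (nextP (n.+1, p n)).2].
exists r; apply/cvg_coord => i0 i; rewrite ord1; apply/cvgrPdist_lt => e e0.
have := near_infty_natSinv_lt (PosNum e0); apply: filterS => n ne.
by rewrite distrC; exact: lt_trans (pP n i) ne.
Qed.

Section deviations.
Variables (R : realType) (d : nat).
Variables (f : torus R d -> torus R d) (F : 'rV[R]_d -> 'rV[R]_d).
Variable phi : torus R d -> 'rV[R]_d.
Hypotheses (f_cont : continuous f) (phi_cont : continuous phi).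
Hypothesis displacementE :
  forall n z, displacement F n z = \sum_(j < n) phi (iter j f z).

Lemma deviation_cocycle rho :
  cocycle f (fun n z => displacement F n z - n%:R *: rho).
Proof.
split=> [n z|m n z].
  apply: (@cvgB _ _ _ (nbhs z) _); last exact: cvg_cst.
  have -> : displacement F n = fun z => \sum_(j < n) phi (iter j f z).
    by apply/funext => z'; rewrite displacementE.
  apply/(@cvg_coord _ _ (nbhs z) _) => i0 i.
  rewrite summxE; under eq_fun do rewrite summxE.
  apply: (@cvg_sumr _ _ (nbhs z) _) => j.
  have : phi (iter j f z') @[z' --> z] --> phi (iter j f z).
    apply: (@cvg_comp _ _ _ (iter j f) phi _ (nbhs (iter j f z))).
      exact: iter_continuous.
    exact: phi_cont.
  by move=> /(@cvg_coord _ _ (nbhs z) _); exact.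
rewrite !displacementE big_split_ord /= natrD scalerDl.
rewrite (eq_bigr (fun j : 'I_n => phi (iter j f (iter m f z)))); last first.
  by move=> j _; rewrite addnC iterD.
by rewrite opprD addrACA.
Qed.

Lemma displacement_bounded :
  exists C : R, forall n z i, `|displacement F n z 0 i| <= n%:R * C.
Proof.
have [C phiC] : exists C : R, forall z i, `|phi z 0 i| <= C.
  have := continuous_compact (continuous_subspaceT phi_cont) (@torus_compact R d).
  move=> /compact_bounded[C [_ /(_ (C + 1))]]; rewrite ltrDl => /(_ ltr01) phiC.
  exists (C + 1) => z i; apply: le_trans (phiC (phi z) _); last by exists z.
  rewrite /Num.Def.normr /= mx_normrE.
  exact: (le_bigmax _ (fun ij => `|phi z ij.1 ij.2|) (0, i)).
exists C => n z i; rewrite displacementE summxE mulr_natl -[in leRHS](card_ord n).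
rewrite -sumr_const; apply: le_trans (ler_norm_sum _ _ _) _.
exact: ler_sum.
Qed.

(* A negative maximum of the n-th deviation would produce a rotation vector
   with a negative component along v relative to rho. *)
Lemma deviation_no_drift (K : set (torus R d)) (V : {vspace 'rV[R]_d})
    (v0 rho v : 'rV[R]_d) n :
  compact K -> K !=set0 -> (forall z, K z -> K (f z)) ->
  rotation_set F K `<=` [set v0 + w | w in orthocompl V] ->
  [set v0 + w | w in orthocompl V] rho -> v \in V ->
  exists2 z, K z & 0 <= deviation F rho v n z.
Proof.
move=> cK [x Kx] Kf rotK [w' w'V rhoE] vV; apply: contrapT => noz.
have neg z : K z -> deviation F rho v n z < 0.
  by move=> Kz; rewrite ltNge; apply/negP => dz; apply: noz; exists z.
have n0 : (0 < n)%N.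
  rewrite lt0n; apply/eqP => n0; have := neg x Kx.
  by rewrite /deviation n0 /displacement subrr scale0r subr0 dotvE mul0mx mxE ltxx.
have cc := deviation_cocycle rho.
have cD : continuous (deviation F rho v n) by exact: (dotv_cocycle_continuous cc).
(* The maximum is attained, hence still negative, so deviations decrease at least linearly along
   multiples of [n]. *)
have [|c /set_mem Kc cmax] := compact_EVT_max _ cK (continuous_subspaceT cD).
  by exists x.
set D := deviation F rho v n c.
have D0 : D < 0 by exact: neg.
have Dq q : forall z, K z -> deviation F rho v (q * n) z <= q%:R * D.
  elim: q => [|q IH] z Kz.
    by rewrite mul0n mul0r /deviation /displacement subrr scale0r subr0 dotvE mul0mx mxE.
  rewrite mulSn /deviation cc.2 dotvDl -natr1 mulrDl mul1r addrC lerD//.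
    apply: IH; elim: (n) => //= m; exact: Kf.
  by apply: cmax; exact: mem_set.
have [C dispC] := displacement_bounded.
(* The successor keeps the times positive for the division. *)
pose m q := (q.+1 * n)%N.
have m0 q : 0 < (m q)%:R :> R by rewrite ltr0n muln_gt0.
have [q i|p p_incr [r ur]] := @rV_bounded_subsequence R d
    (fun q => (m q)%:R^-1 *: displacement F (m q) x) C.
  rewrite /= mxE normrM normfV normr_nat.
  by rewrite ler_pdivrMl.
have [|w wV rE] := rotK r.
  exists (fun i => m (p i)), (fun=> x); split => //.
  apply/increasing_seqP => i; rewrite /m ltEnat /= ltn_pmul2r// ltnS.
  by move/increasing_seqP: p_incr => /(_ i).
have lim0 : dotv ((m (p i))%:R^-1 *: displacement F (m (p i)) x - rho) v @[i --> \oo]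
    --> dotv (r - rho) v.
  by apply: cvg_dotv; [apply: cvgB => //; exact: cvg_cst|exact: cvg_cst].
(* The limit is 0, as [r] and [rho] differ by a vector orthogonal to [V], whereas the averages stay
   at most [D / n%:R]. *)
have Dn : D / n%:R < dotv (r - rho) v.
  rewrite -rE -rhoE opprD addrACA subrr add0r dotvBl w'V// wV// subrr.
  by rewrite pmulr_llt0 ?invr_gt0 ?ltr0n.
have /filter_ex[i] : \forall i \near \oo,
    D / n%:R < dotv ((m (p i))%:R^-1 *: displacement F (m (p i)) x - rho) v.
  exact: (lim0 _ (lt_nbhsr Dn)).
apply/negP; rewrite -leNgt.
have -> : (m (p i))%:R^-1 *: displacement F (m (p i)) x - rho =
    (m (p i))%:R^-1 *: (displacement F (m (p i)) x - (m (p i))%:R *: rho).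
  by rewrite [RHS]scalerBr scalerA mulVf ?scale1r// gt_eqF.
rewrite dotvZl ler_pdivrMl//; apply: le_trans (Dq _ _ Kx) _.
by rewrite natrM -mulrA (mulrCA n%:R) divff ?mulr1// pnatr_eq0 -lt0n.
Qed.

End deviations.

(** * Infinite suprema and infima, and the conclusion *)

Lemma ereal_sup_unbounded (R : realType) (u : nat -> R) :
  ~ (exists M, forall n, u n <= M) ->
  ereal_sup [set (u n)%:E | n in [set: nat]] = +oo%E.
Proof.
move=> nM.
have ub n : ((u n)%:E <= ereal_sup [set (u n)%:E | n in [set: nat]])%E.
  by apply: ereal_sup_ubound; exists n.
move: ub; case: ereal_sup => [M ub|//|ub]; last by have := ub 0%N.
by exfalso; apply: nM; exists M => n; have := ub n; rewrite lee_fin.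
Qed.

Lemma ereal_inf_unbounded (R : realType) (u : nat -> R) :
  ~ (exists M, forall n, - u n <= M) ->
  (- ereal_inf [set (u n)%:E | n in [set: nat]])%E = +oo%E.
Proof.
move=> nM.
have lb n : (ereal_inf [set (u n)%:E | n in [set: nat]] <= (u n)%:E)%E.
  by apply: ereal_inf_lbound; exists n.
move: lb; case: ereal_inf => [M lb|lb|//]; last by have := lb 0%N.
by exfalso; apply: nM; exists (- M) => n; have := lb n; rewrite lee_fin lerN2.
Qed.

Theorem theorem3p6 (R : realType) (d : nat) (f : torus R d -> torus R d)
    (F : 'rV[R]_d -> 'rV[R]_d) (K : set (torus R d))
    (V : {vspace 'rV[R]_d}) (v0 rho : 'rV[R]_d) :
  @Homeo0 R d f ->
  is_lift f F ->
  compact K ->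
  f @` K = K ->
  minimal_on f K ->
  v0 \in V ->
  rotation_set F K `<=` [set v0 + w | w in orthocompl V] ->
  [set v0 + w | w in orthocompl V] rho ->
  (forall v, v \in V -> v != 0 ->
     ereal_sup [set (`|deviation F rho v p.1 p.2|)%:E
               | p in [set: nat] `*` K] = +oo%E) ->
  exists A : set (torus R d),
    residual_in K A /\
    forall z, A z -> forall v, v \in V -> v != 0 ->
      ereal_sup [set (deviation F rho v n z)%:E | n in [set: nat]] = +oo%E /\
      (- ereal_inf [set (deviation F rho v n z)%:E | n in [set: nat]])%E
        = +oo%E.
Proof.
move=> f0 lF cK fK mK _ rotK rhoV unb.
have [phi cphi Fphi] := lift_displacement f0 lF.
have dispE := displacement_sum lF Fphi.
have [[cf [g [cg fgK gfK]]] _] := f0.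
have Kf z : K z -> K (f z) by move=> Kz; rewrite -fK; exists z.
have Kg z : K z -> K (g z) by rewrite -{1}fK => -[y Ky <-]; rewrite fgK.
(* With a basis of [V] as rows, nonzero coordinate vectors [c] correspond to nonzero [v] in [V], so
   the cocycle can be studied in all its directions. *)
pose B : 'M[R]_(\dim V, d) := \matrix_i (vbasis V)`_i.
have mulB (c : 'rV[R]_(\dim V)) : c *m B = \sum_i c 0 i *: (vbasis V)`_i.
  by rewrite mulmx_sum_row; apply: eq_bigr => i _; rewrite rowK.
have BV (c : 'rV[R]_(\dim V)) : c *m B \in V.
  rewrite mulB; apply: memv_suml => i _; apply: memvZ; apply: vbasis_mem.
  by apply: mem_nth; rewrite size_tuple.
have B0 (c : 'rV[R]_(\dim V)) : c != 0 -> c *m B != 0.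
  apply: contra => /eqP; rewrite mulB => cB; apply/eqP/rowP => i; rewrite mxE.
  by have /freeP := basis_free (vbasisP V); apply.
have VB v : v \in V -> exists c : 'rV[R]_(\dim V), v = c *m B.
  move=> vV; exists (\row_i coord (vbasis V) i v).
  by rewrite mulB {1}(coord_vbasis vV); apply: eq_bigr => i _; rewrite mxE.
pose S n z := (displacement F n z - n%:R *: rho) *m B^T.
have cS : cocycle f S.
  by apply: cocycle_mulmx; exact: (deviation_cocycle cf cphi dispE).
have SE n z c : dotv (S n z) c = deviation F rho (c *m B) n z.
  by rewrite /S dotv_mulmx.
have : generically K (fun z => forall c : 'rV[R]_(\dim V), c != 0 ->
    ~ bounded_dir S z c).
  have [/eqP ->|/set0P K0] := boolP (K == set0).
    by apply: generically_all.
  apply: (generically_unbounded_all fgK Kf Kg mK cS) => c c0.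
  apply: (generically_unbounded cf cg fgK gfK cK Kf Kg mK cS) => [n|M].
    have [z Kz dz] := deviation_no_drift cf cphi dispE n cK K0 Kf rotK rhoV (BV c).
    by exists z => //; rewrite SE.
  apply: contrapT => nM; have := unb _ (BV c) (B0 c c0); apply/eqP.
  rewrite lt_eqF// (@le_lt_trans _ _ M%:E) ?ltry//.
  apply: ge_ereal_sup => _ [[n z] [/= _ Kz] <-]; rewrite lee_fin leNgt.
  by apply/negP => Mz; apply: nM; exists n, z; rewrite SE.
move=> /(generically_residual (@torus_hausdorff R d) (@torus_compact R d) cK).
move=> [A rA AP]; exists A; split => // z Az v vV vn0.
have [c vE] := VB v vV.
have c0 : c != 0 by apply: contraNneq vn0 => c0; rewrite vE c0 mul0mx.
split.
  apply: ereal_sup_unbounded => -[M uM]; apply: (AP z Az c c0).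
  by exists M => n; rewrite SE -vE.
(* Unboundedness below along [v] is unboundedness above in direction [- c]. *)
apply: ereal_inf_unbounded => -[M uM]; apply: (AP z Az (- c)).
  by rewrite oppr_eq0.
by exists M => n; rewrite dotvNr SE -vE.
Qed.
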